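(* Let $(R,m,k)$ be a complete regular local ring with algebraically closed residue field $k$. Suppose that for every $r\ge 1$, every choice of monic polynomials $f_i(y_i)=y_i^{n_i}+a_{i,1}y_i^{n_i-1}+\cdots+a_{i,n_i}\in R[y_i]$ ($i=1,\dots,r$, $n_i\ge 1$) with all $a_{i,j}\in m$, and every ideal $J$ of height zero in $$T=R[y_1,\dots,y_r]/(f_1(y_1),\dots,f_r(y_r))$$ such that the natural map $R\to T/J$ is injective, the ring $R$ is a direct summand of $T/J$ as an $R$-module. Then for every module-finite ring extension $R\hookrightarrow S$, $R$ is a direct summand of $S$ as an $R$-module (i.e. there is an $R$-linear map $\rho:S\to R$ with $\rho(1)=1$).
   Context: All rings are commutative Noetherian with identity. *)

(* Defs.v *)
From HB Require Import structures.
From mathcomp Require Import all_boot all_order all_algebra.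
Set Implicit Arguments. Unset Strict Implicit. Unset Printing Implicit Defensive.
Import Order.TTheory GRing.Theory Num.Theory.
Local Open Scope ring_scope.

Section CommAlg.
Variable R : comNzRingType.

Definition is_ideal (I : R -> Prop) : Prop :=
  I 0 /\ (forall x y, I x -> I y -> I (x + y)) /\ (forall a x, I x -> I (a * x)).

Definition ideal_gen (s : seq R) (x : R) : Prop :=
  exists c : seq R, x = \sum_(i < size s) c`_i * s`_i.

Definition fg_ideal (I : R -> Prop) : Prop :=
  exists s : seq R, forall x, I x <-> ideal_gen s x.

Definition noetherian : Prop := forall I, is_ideal I -> fg_ideal I.

Definition is_unit_el (x : R) : Prop := exists y, x * y = 1.

Definition prime_ideal (P : R -> Prop) : Prop :=
  is_ideal P /\ ~ P 1 /\ (forall x y, P (x * y) -> P x \/ P y).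

Definition strict_sub (P Q : R -> Prop) : Prop :=
  (forall x, P x -> Q x) /\ exists x, Q x /\ ~ P x.

Definition prime_chain (c : nat -> R -> Prop) (n : nat) : Prop :=
  (forall i, (i <= n)%N -> prime_ideal (c i)) /\
  (forall i, (i < n)%N -> strict_sub (c i) (c i.+1)).

Definition krull_dim_eq (d : nat) : Prop :=
  (exists c, prime_chain c d) /\ ~ (exists c, prime_chain c d.+1).

Definition prime_height_ge (P : R -> Prop) (n : nat) : Prop :=
  exists c, prime_chain c n /\ (forall x, c n x <-> P x).

(* height J = min over primes P containing J of height P, which is 0 *)
Definition height_zero (J : R -> Prop) : Prop :=
  exists P, prime_ideal P /\ (forall x, J x -> P x) /\ ~ prime_height_ge P 1.

Definition local_ring_with (m : R -> Prop) : Prop :=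
  is_ideal m /\ ~ m 1 /\ (forall x, ~ m x -> is_unit_el x).

Fixpoint ideal_pow (m : R -> Prop) (n : nat) : R -> Prop :=
  match n with
  | 0 => fun _ => True
  | n'.+1 => fun x => exists s : seq (R * R),
       (forall i, (i < size s)%N -> m (nth (0, 0) s i).1 /\ ideal_pow m n' (nth (0, 0) s i).2)
       /\ x = \sum_(p <- s) p.1 * p.2
  end.

Definition madic_complete (m : R -> Prop) : Prop :=
  (forall x, (forall n, ideal_pow m n x) -> x = 0) /\
  (forall u : nat -> R,
     (forall k, exists N, forall p q, (N <= p)%N -> (N <= q)%N -> ideal_pow m k (u p - u q)) ->
     exists L, forall k, exists N, forall n, (N <= n)%N -> ideal_pow m k (u n - L)).

Definition regular_local (m : R -> Prop) : Prop :=
  exists d, krull_dim_eq d /\ exists s : seq R, size s = d /\ (forall x, m x <-> ideal_gen s x).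

(* residue field R/m is algebraically closed: every monic nonconstant polynomial
   over R/m (lifted to a monic polynomial over R) has a root in R/m *)
Definition residue_alg_closed (m : R -> Prop) : Prop :=
  forall p : {poly R}, p \is monic -> (1 < size p)%N -> exists a, m p.[a].

Definition complete_regular_local_alg_closed (m : R -> Prop) : Prop :=
  noetherian /\ local_ring_with m /\ madic_complete m /\ regular_local m /\
  residue_alg_closed m.

Definition R_linear (S : comNzRingType) (f : {rmorphism R -> S}) (rho : S -> R) : Prop :=
  forall a x y, rho (f a * x + y) = a * rho x + rho y.

Definition module_finite (S : comNzRingType) (f : {rmorphism R -> S}) : Prop :=
  exists s : seq S, forall x, exists c : seq R, x = \sum_(i < size s) f c`_i * s`_i.

Definition direct_summand (S : comNzRingType) (f : {rmorphism R -> S}) : Prop :=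
  exists rho : S -> R, R_linear f rho /\ rho 1 = 1.

(* (T, g, y) is R[y_1..y_r]/(F_1(y_1),...,F_r(y_r)), via its universal property *)
Definition is_poly_quotient (r : nat) (F : 'I_r -> {poly R})
  (T : comNzRingType) (g : {rmorphism R -> T}) (y : 'I_r -> T) : Prop :=
  (forall i, (map_poly g (F i)).[y i] = 0) /\
  forall (T' : comNzRingType) (g' : {rmorphism R -> T'}) (y' : 'I_r -> T'),
    (forall i, (map_poly g' (F i)).[y' i] = 0) ->
    (exists h : {rmorphism T -> T'}, (forall a, h (g a) = g' a) /\ (forall i, h (y i) = y' i)) /\
    (forall h1 h2 : {rmorphism T -> T'},
       (forall a, h1 (g a) = g' a) -> (forall i, h1 (y i) = y' i) ->
       (forall a, h2 (g a) = g' a) -> (forall i, h2 (y i) = y' i) ->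
       forall t, h1 t = h2 t).

End CommAlg.

(* f_i(y) = y^n + a_1 y^(n-1) + ... + a_n, with a j = a_(j+1) *)
Definition monic_poly_of (R : comNzRingType) (n : nat) (a : 'I_n -> R) : {poly R} :=
  'X^n + \sum_(j < n) (a j)%:P * 'X^(n - j.+1).

(* Main.v *)
Require Import Defs.
From HB Require Import structures.
From mathcomp Require Import all_boot all_order all_algebra.
From mathcomp Require Import boolp classical_sets.
From mathcomp Require Import ring zify.
Set Implicit Arguments. Unset Strict Implicit. Unset Printing Implicit Defensive.
Import GRing.Theory.
Local Open Scope ring_scope.

(* A regular local ring is a domain, so some prime [P] of [S] meets [R] in 0,
   and it suffices to split [R -> S/P]. Each generator of the domain [S/P] is
   integral over [R]; since [R] is Henselian with algebraically closed residue
   field, a translate of it by an element of [R] is a root of a monic polynomial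
   whose lower coefficients lie in [m]. Hence [S/P] is a quotient of the ring
   [T] attached to these polynomials, and the kernel is a prime of the integral
   extension [T] of [R] lying over 0, so it has height zero by
   incomparability.

   That regular local rings are domains is proved inside [R], by adjoining the
   generators of [m] to an ideal one at a time. Krull's principal ideal theorem
   is proved without localizing: ideals of the localization at [Q] are replaced
   by [Q]-saturated ideals. *)

(** * Ideals, maximal members of families of ideals, and prime ideals *)

Section Ideals.
Variable R : comNzRingType.
Implicit Types (I J K P Q : R -> Prop).

Definition sub_ideal I J : Prop := forall x, I x -> J x.

Lemma ideal0 I : is_ideal I -> I 0. Proof. by case. Qed.

Lemma idealD I x y : is_ideal I -> I x -> I y -> I (x + y).
Proof. by move=> [_ [h _]]; exact: h. Qed.

Lemma ideal_mull I a x : is_ideal I -> I x -> I (a * x).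
Proof. by move=> [_ [_ h]]; exact: h. Qed.

Lemma ideal_mulr I a x : is_ideal I -> I x -> I (x * a).
Proof. by rewrite mulrC; exact: ideal_mull. Qed.

Lemma idealN I x : is_ideal I -> I x -> I (- x).
Proof. by rewrite -mulN1r; exact: ideal_mull. Qed.

Lemma idealB I x y : is_ideal I -> I x -> I y -> I (x - y).
Proof. by move=> hI Ix Iy; apply: idealD => //; exact: idealN. Qed.

Lemma ideal_sum I (T : Type) (s : seq T) (A : pred T) (E : T -> R) :
  is_ideal I -> (forall i, A i -> I (E i)) -> I (\sum_(i <- s | A i) E i).
Proof.
by move=> hI hE; apply: big_ind => //; [exact: ideal0 | move=> *; exact: idealD].
Qed.

Lemma ideal_gen_min (s : seq R) I :
  is_ideal I -> (forall x, x \in s -> I x) -> sub_ideal (ideal_gen s) I.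
Proof.
move=> hI hs _ [c ->]; apply: ideal_sum => // i _; apply: ideal_mull => //.
by apply: hs; exact: mem_nth.
Qed.

Lemma mem_ideal_gen (s : seq R) x : x \in s -> ideal_gen s x.
Proof.
(* Coefficients past the end of a list read as the default 0, so the list may stop at its 1. *)
move=> xs; exists (nseq (index x s) 0 ++ [:: 1]).
have lt : (index x s < size s)%N by rewrite index_mem.
rewrite (bigD1 (Ordinal lt)) //= nth_cat size_nseq ltnn subnn /= mul1r.
rewrite nth_index // big1 ?addr0 // => i; rewrite -val_eqE /= => ne.
rewrite nth_cat size_nseq nth_nseq.
case: (ltngtP i (index x s)) ne => [||->]; rewrite ?eqxx ?mul0r // => gt _.
by rewrite nth_default ?mul0r //= subn_gt0.
Qed.

Definition adjoin I x : R -> Prop := fun z => exists a r, I a /\ z = a + r * x.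

Lemma adjoin_ideal I x : is_ideal I -> is_ideal (adjoin I x).
Proof.
move=> hI; split; first by exists 0, 0; split; [exact: ideal0 | ring].
split=> [_ _ [a [r [Ia ->]]] [b [t [Ib ->]]]|c _ [a [r [Ia ->]]]].
  by exists (a + b), (r + t); split; [exact: idealD | ring].
by exists (c * a), (c * r); split; [exact: ideal_mull | ring].
Qed.

Lemma sub_adjoin I x : sub_ideal I (adjoin I x).
Proof. by move=> a Ia; exists a, 0; split=> //; ring. Qed.

Lemma mem_adjoin I x : is_ideal I -> adjoin I x x.
Proof. by move=> hI; exists 0, 1; split; [exact: ideal0 | ring]. Qed.

Lemma adjoin_min I J x : is_ideal J -> sub_ideal I J -> J x ->
  sub_ideal (adjoin I x) J.
Proof.
by move=> hJ sIJ Jx _ [a [r [/sIJ Ja ->]]]; apply: idealD => //; exact: ideal_mull.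
Qed.

Lemma prime_exp P x n : prime_ideal P -> P (x ^+ n) -> P x.
Proof.
move=> [_ [P1 hP]]; elim: n => [/P1 //|n IH]; rewrite exprS => /hP [] //.
Qed.

Lemma chain_union_ideal (C : set (set R)) (I0 : set R) :
  C I0 -> (forall I, C I -> is_ideal I) -> total_on C subset ->
  is_ideal (\bigcup_(X in C) X)%classic.
Proof.
move=> CI0 hC tC; split; first by exists I0 => //; apply: ideal0; exact: hC.
split=> [x y [I CI Ix] [J CJ Jy]|a x [I CI Ix]].
  have [sIJ|sJI] := tC _ _ CI CJ.
    by exists J => //; apply: idealD; [exact: hC | exact: sIJ |].
  by exists I => //; apply: idealD; [exact: hC | | exact: sJI].
by exists I => //; apply: ideal_mull => //; exact: hC.
Qed.

(** Zorn's lemma also asks for the union of the empty chain, which need not be in [F]. The empty set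
    is therefore added to the family; it is never maximal, because [I0] contains 0. *)
Lemma ideal_zorn (F : set (set R)) I0 : F I0 ->
  (forall I, F I -> is_ideal I) ->
  (forall C, (C `<=` F)%classic -> (exists I, C I) -> total_on C subset ->
     F (\bigcup_(X in C) X)%classic) ->
  exists M, [/\ F M, sub_ideal I0 M &
    forall J, F J -> sub_ideal M J -> sub_ideal J M].
Proof.
move=> FI0 Fid Fch.
pose G (X : set R) := X = set0 \/ (F X /\ sub_ideal I0 X).
have [C CG tC|M [GM maxM]] := @Zorn_bigcup R G.
  pose D : set (set R) := fun X => C X /\ exists x, X x.
  have -> : (\bigcup_(X in C) X = \bigcup_(X in D) X)%classic.
    apply/seteqP; split=> [x [X CX Xx]|x [X [CX _] Xx]]; last by exists X.
    by exists X => //; split=> //; exists x.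
  have DF X : D X -> F X /\ sub_ideal I0 X.
    by move=> [/CG[->|//]] [x].
  case: (pselect (exists X, D X)) => [[X DX]|nD]; last first.
    by left; apply/seteqP; split=> // x [X DX _]; case: nD; exists X.
  right; split.
    apply: Fch; [by move=> Y /DF[] | by exists X |].
    by move=> Y Z [CY _] [CZ _]; exact: tC.
  by move=> x I0x; exists X => //; exact: (DF _ DX).2.
have I0_0 : I0 0 by apply: ideal0; exact: Fid.
case: GM => [M0|[FM sM]].
  case: (maxM I0); last by right; split.
  by rewrite M0; split=> // /(_ _ I0_0).
exists M; split=> // J FJ sMJ; apply: contrapT => nJM.
by case: (maxM J); [split | right; split=> // x /sM /sMJ].
Qed.

Lemma chain_common (C : set (set R)) (s : seq R) (I0 : set R) :
  C I0 -> total_on C subset ->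
  (forall x, x \in s -> exists2 I, C I & I x) ->
  exists2 I, C I & forall x, x \in s -> I x.
Proof.
move=> CI0 tC; elim: s => [_|x s IH hs]; first by exists I0.
have [|I CI hI] := IH; first by move=> y ys; apply: hs; rewrite inE ys orbT.
have [|J CJ Jx] := hs x; first by rewrite inE eqxx.
have [sIJ|sJI] := tC _ _ CI CJ.
  by exists J => // y; rewrite inE => /predU1P [->|/hI /sIJ].
by exists I => // y; rewrite inE => /predU1P [->|/hI //]; exact: sJI.
Qed.

(** The union of a chain is finitely generated, and a member of the chain that contains all the
    generators equals the union. *)
Lemma noetherian_maximal (F : (R -> Prop) -> Prop) I0 : noetherian R -> F I0 ->
  (forall I, F I -> is_ideal I) ->
  exists M, [/\ F M, sub_ideal I0 M &
    forall J, F J -> sub_ideal M J -> sub_ideal J M].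
Proof.
move=> noeR FI0 Fid; apply: ideal_zorn => // C CF [I CI] tC.
have hC : is_ideal (\bigcup_(X in C) X)%classic.
  by apply: chain_union_ideal CI _ tC => J /CF /Fid.
have [s hs] := noeR _ hC.
have [x xs|J CJ hJ] := chain_common (s := s) CI tC.
  by have /hs[X] := mem_ideal_gen xs; exists X.
suff -> : (\bigcup_(X in C) X)%classic = J by exact: CF.
apply/seteqP; split=> [x /hs|x Jx]; last by exists J.
by apply: ideal_gen_min => //; apply/Fid/CF.
Qed.

Definition avoids I (A : R -> Prop) : Prop := forall x, I x -> ~ A x.

(** Take [P] maximal among the ideals disjoint from [A]. If [x] and [y] lie outside [P], then
    [P + (x)] and [P + (y)] meet [A]; were [x * y] in [P], the product of the two common elements
    would lie in both [P] and [A]. *)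
Lemma prime_avoiding (A : R -> Prop) : A 1 ->
  (forall x y, A x -> A y -> A (x * y)) -> ~ A 0 ->
  exists2 P, prime_ideal P & avoids P A.
Proof.
move=> A1 AM A0; pose F : set (set R) := fun I => is_ideal I /\ avoids I A.
have F0 : F (fun x => x = 0).
  split; last by move=> x ->.
  by split=> //; split=> [x y -> ->|a x ->]; rewrite ?addr0 ?mulr0.
have [I []//|C CF [I CI] tC|P [[hP avP] _ maxP]] := ideal_zorn F0.
  split; first by apply: chain_union_ideal CI _ tC => J /CF[].
  by move=> x [J /CF[_ avJ] /avJ].
have meets x : ~ P x -> exists2 a, adjoin P x a & A a.
  move=> nPx; apply: contrapT => nA; apply: nPx.
  apply: (maxP (adjoin P x)); [|exact: sub_adjoin|exact: mem_adjoin].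
  split; first exact: adjoin_ideal.
  by move=> a aPx Aa; apply: nA; exists a.
exists P => //; split=> //; split=> [/avP //|x y Pxy].
apply: contrapT => /not_orP[/meets[_ [a [r [Pa ->]]] Ax]].
move=> /meets[_ [b [t [Pb ->]]] Ay].
apply: (avP _ _ (AM _ _ Ax Ay)).
have -> : (a + r * x) * (b + t * y) =
  (b + t * y) * a + r * x * b + r * t * (x * y) by ring.
by do 2?[apply: idealD => //]; exact: ideal_mull.
Qed.

End Ideals.

(** * Krull's principal ideal theorem *)

Section PrincipalIdealTheorem.
Variable R : comNzRingType.
Implicit Types (I J K P Q : R -> Prop).

(** For a prime [Q], the saturated ideals are the contractions of ideals of the localization at [Q],
    and [saturation Q I] is the contraction of the extension of [I]. *)
Definition saturated Q I : Prop := forall s x, ~ Q s -> I (s * x) -> I x.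

Definition saturation Q I : R -> Prop := fun x => exists2 s, ~ Q s & I (s * x).

Lemma prime_compl Q x y : prime_ideal Q -> ~ Q x -> ~ Q y -> ~ Q (x * y).
Proof. by move=> [_ [_ hQ]] nx ny /hQ[]. Qed.

Lemma saturation_ideal Q I :
  prime_ideal Q -> is_ideal I -> is_ideal (saturation Q I).
Proof.
move=> hQ hI; split; first by exists 1; [exact: hQ.2.1 | rewrite mulr0; exact: ideal0].
split=> [x y [s nQs Isx] [t nQt Ity]|a x [s nQs Isx]].
  exists (s * t); first exact: prime_compl.
  have -> : s * t * (x + y) = t * (s * x) + s * (t * y) by ring.
  by apply: idealD => //; exact: ideal_mull.
by exists s => //; rewrite mulrCA; exact: ideal_mull.
Qed.

Lemma saturation_saturated Q I :
  prime_ideal Q -> is_ideal I -> saturated Q (saturation Q I).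
Proof.
move=> hQ hI s x nQs [t nQt Itsx]; exists (t * s); first exact: prime_compl.
by rewrite -mulrA.
Qed.

Lemma sub_saturation Q I : prime_ideal Q -> sub_ideal I (saturation Q I).
Proof. by move=> [_ [Q1 _]] x Ix; exists 1; rewrite ?mul1r. Qed.

Lemma saturated1 Q I s : is_ideal I -> saturated Q I -> ~ Q s -> I s -> forall x, I x.
Proof. by move=> hI sI nQs Is x; apply: sI nQs _; exact: ideal_mulr. Qed.

(* If [Q] is minimal over [A], then the localization at [Q] of the quotient
   by [A] is Artinian. Noetherian induction on [K]: when [ab] is in [K] but
   neither [a] nor [b] is, a chain [L] over [K] is controlled by the chains
   [L + (a)] and [(L : a)], which lie over larger ideals. *)
Lemma saturated_dcc Q A : noetherian R -> prime_ideal Q -> is_ideal A ->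
  (forall P, prime_ideal P -> sub_ideal A P -> sub_ideal P Q -> sub_ideal Q P) ->
  forall L : nat -> R -> Prop,
    (forall n, [/\ is_ideal (L n), saturated Q (L n), sub_ideal A (L n) &
       sub_ideal (L n.+1) (L n)]) ->
  exists N, forall n, (N <= n)%N -> sub_ideal (L n) (L n.+1).
Proof.
move=> noeR hQ hA minQ.
pose dcc K := forall L : nat -> R -> Prop,
    (forall n, [/\ is_ideal (L n), saturated Q (L n), sub_ideal K (L n) &
       sub_ideal (L n.+1) (L n)]) ->
  exists N, forall n, (N <= n)%N -> sub_ideal (L n) (L n.+1).
suff : dcc A by [].
apply: contrapT => ndccA.
pose F K := [/\ is_ideal K, sub_ideal A K & ~ dcc K].
have [||K [[hK sAK ndccK] _ maxK]] := @noetherian_maximal R F A noeR.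
- by split.
- by move=> I [].
apply: (ndccK) => L hL.
have Lanti p q : (p <= q)%N -> sub_ideal (L q) (L p).
  move=> /subnK <-; elim: (q - p)%N => [//|d IH] x.
  by rewrite addSn; have [_ _ _ s] := hL (d + p)%N; move=> /s; exact: IH.
(* If every [L n] is the unit ideal, the chain is constant. Otherwise its terms lie in [Q] from [N]
   on, since a saturated ideal with an element outside [Q] is the whole ring. *)
case: (pselect (exists N, ~ L N 1)) => [[N nLN1]|allL]; last first.
  exists 0 => n _ x _; have [hL' _ _ _] := hL n.+1.
  rewrite -[x]mulr1; apply: ideal_mull => //; apply: contrapT => h.
  by apply: allL; exists n.+1.
have LQ n : (N <= n)%N -> sub_ideal (L n) Q.
  move=> Nn x Lnx; apply: contrapT => nQx; apply: nLN1; apply: (Lanti _ _ Nn).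
  by have [hLn sLn _ _] := hL n; exact: saturated1 sLn nQx Lnx _.
have K_sub n : sub_ideal K (L n) by have [] := hL n.
have nK1 : ~ K 1 by move=> /(K_sub N).
(* For prime [K], minimality of [Q] squeezes the chain: [L n] lies in [Q], hence in [K], hence in
   [L n.+1]. *)
case: (pselect (prime_ideal K)) => [pK|npK].
  exists N => n Nn x /(LQ _ Nn) Qx; apply: (K_sub); apply: minQ Qx => //.
  by move=> y /(K_sub N); exact: LQ.
have [a [b [Kab nKa nKb]]] : exists a b, [/\ K (a * b), ~ K a & ~ K b].
  apply: contrapT => nab; apply: npK; split=> //; split=> // x y Kxy.
  by apply: contrapT => /not_orP[nx ny]; apply: nab; exists x, y.
have dcc_big K' c : is_ideal K' -> sub_ideal K K' -> K' c -> ~ K c -> dcc K'.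
  move=> hK' sKK' K'c nKc; apply: contrapT => nd; apply: nKc.
  by apply: (maxK K') => //; split=> // x /sAK /sKK'.
(* This chain lies over [K + (a)]. The saturation is taken because [L n + (a)] need not be
   saturated. *)
have [N1 hN1] : exists N1, forall n, (N1 <= n)%N ->
    sub_ideal (saturation Q (adjoin (L n) a)) (saturation Q (adjoin (L n.+1) a)).
  apply: (dcc_big (adjoin K a) a);
    [exact: adjoin_ideal | exact: sub_adjoin | exact: mem_adjoin | done |].
  move=> n; have [hLn sLn _ sub] := hL n.
  have hLna := adjoin_ideal a hLn; split.
  - exact: saturation_ideal.
  - exact: saturation_saturated.
  - move=> _ [k [r [Kk ->]]]; apply: sub_saturation => //.
    by exists k, r; split=> //; exact: K_sub.
  - move=> x [s nQs [l [r [Ll e]]]]; exists s => //; exists l, r.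
    by split=> //; exact: sub.
(* This chain [(L n : a)] lies over [(K : a)], which contains [b]. *)
have [N2 hN2] : exists N2, forall n, (N2 <= n)%N ->
    sub_ideal (fun r => L n (r * a)) (fun r => L n.+1 (r * a)).
  apply: (dcc_big (fun r => K (r * a)) b); last first.
  - move=> n; have [hLn sLn _ sub] := hL n; split.
    + split; first by rewrite mul0r; exact: ideal0.
      split=> [x y Lx Ly|c x Lx]; first by rewrite mulrDl; exact: idealD.
      by rewrite -mulrA; exact: ideal_mull.
    + by move=> s x nQs; rewrite -mulrA; exact: sLn.
    + by move=> r /K_sub.
    + by move=> r /sub.
  - by [].
  - by rewrite mulrC.
  - by move=> x Kx; exact: ideal_mulr.
  - split; first by rewrite mul0r; exact: ideal0.
    split=> [x y Lx Ly|c x Lx]; first by rewrite mulrDl; exact: idealD.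
    by rewrite -mulrA; exact: ideal_mull.
(* Write [s * y = l + r * a] with [l] in [L n.+1]. Then [r * a = s * y - l] is in [L n], hence in
   [L n.+1] by stability of the colon ideals, and [s] cancels by saturation. *)
exists (maxn N1 N2) => n; rewrite geq_max => /andP[n1 n2] y Lny.
have [hLn sLn _ sub] := hL n; have [hLn1 sLn1 _ _] := hL n.+1.
have [|s nQs [l [r [Ll e]]]] := hN1 n n1 y.
  by apply: sub_saturation => //; exact: sub_adjoin.
apply: (sLn1 s) => //; rewrite e; apply: idealD => //; apply: hN2 => //.
have -> : r * a = s * y - l by rewrite e; ring.
by apply: idealB; [| exact: ideal_mull | exact: sub].
Qed.

(** Let [K] be maximal among the saturated ideals between [I] and [J] that differ from [J]. Locally
    at [Q], any [g] in [J] outside [K] generates [J] over [K], so [s * g = a + u * r] and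
    [t * r = k + c * g] give [(t * s - u * c) * g] in [K], where the factor is outside [Q] because
    [u] is in [Q]. *)
Lemma saturated_nakayama Q I J u : noetherian R -> prime_ideal Q ->
  is_ideal I -> is_ideal J -> saturated Q I -> saturated Q J ->
  sub_ideal I J -> Q u ->
  (forall z, J z -> exists s a r, [/\ ~ Q s, I a, J r & s * z = a + u * r]) ->
  sub_ideal J I.
Proof.
move=> noeR hQ hI hJ sI sJ sIJ Qu hz; apply: contrapT => nJI.
pose F K := [/\ is_ideal K, saturated Q K, sub_ideal K J & ~ sub_ideal J K].
have [||K [[hK sK sKJ nJK] sIK maxK]] := @noetherian_maximal R F I noeR.
- by split.
- by move=> ? [].
apply: (nJK) => g Jg; apply: contrapT => nKg.
have Jsat : sub_ideal J (saturation Q (adjoin K g)).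
  have hKg := adjoin_ideal g hK.
  apply: contrapT => nsub; apply: nKg; apply: (maxK (saturation Q (adjoin K g))).
  - split=> //; [exact: saturation_ideal|exact: saturation_saturated|].
    by move=> x [s nQs /(adjoin_min hJ sKJ Jg)]; exact: sJ.
  - by move=> x Kx; apply: sub_saturation => //; exact: sub_adjoin.
  - by apply: sub_saturation => //; exact: mem_adjoin.
have [s [a [r [nQs Ia Jr e]]]] := hz _ Jg.
have [t nQt [k [c [Kk e']]]] := Jsat _ Jr.
apply: nKg; apply: (sK (t * s - u * c)).
  move=> h; apply: (prime_compl hQ nQt nQs).
  have -> : t * s = (t * s - u * c) + u * c by ring.
  by apply: idealD => //; [exact: hQ.1 | apply: ideal_mulr => //; exact: hQ.1].
have -> : (t * s - u * c) * g = t * a + u * k.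
  have -> : t * a + u * k = t * (a + u * r) - u * (t * r - k) by ring.
  by rewrite -e e'; ring.
by apply: idealD => //; apply: ideal_mull => //; exact: sIK.
Qed.

(* Krull's principal ideal theorem. If [Q] were minimal over [P0 + (u)], the
   chain of the [J n], the elements that [u]-powers carry into [(y ^+ n) + P0]
   locally at [Q], would stabilise modulo [u], hence by Nakayama's lemma, and
   then [y] would divide a power of [u] modulo [P0], locally at [Q]. *)
Lemma krull_principal_ideal P0 P1 Q u : noetherian R ->
  prime_ideal P0 -> prime_ideal P1 -> prime_ideal Q ->
  strict_sub P0 P1 -> strict_sub P1 Q -> Q u ->
  exists P, [/\ prime_ideal P, strict_sub P0 P, strict_sub P Q & P u].
Proof.
move=> noeR hP0 hP1 hQ s01 s1Q Qu.
have [P1u|nP1u] := pselect (P1 u); first by exists P1.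
have [s01' [y [P1y nP0y]]] := s01.
have iP0 := hP0.1; have iQ := hQ.1.
apply: contrapT => noP.
have minQ P : prime_ideal P -> sub_ideal (adjoin P0 u) P -> sub_ideal P Q ->
    sub_ideal Q P.
  move=> hP sP sPQ x Qx; apply: contrapT => nPx; apply: noP; exists P.
  have Pu : P u by apply: sP; exact: mem_adjoin.
  split=> //; split=> //.
  - by move=> z /(@sub_adjoin _ _ u) /sP.
  - by exists u; split=> // /s01'.
  - by exists x.
pose J n z := exists k s, ~ Q s /\ adjoin P0 (y ^+ n) (s * u ^+ k * z).
have hJ n : is_ideal (J n).
  have hA := adjoin_ideal (y ^+ n) iP0.
  split; first by exists 0%N, 1; split; [exact: hQ.2.1 | rewrite mulr0; exact: ideal0].
  split=> [a b [k [s [nQs ha]]] [l [t [nQt hb]]]|c a [k [s [nQs ha]]]].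
    exists (k + l)%N, (s * t); split; first exact: prime_compl.
    have -> : s * t * u ^+ (k + l) * (a + b) =
      t * u ^+ l * (s * u ^+ k * a) + s * u ^+ k * (t * u ^+ l * b).
      by rewrite exprD; ring.
    by apply: idealD => //; exact: ideal_mull.
  exists k, s; split=> //.
  by rewrite mulrCA; exact: ideal_mull.
have sJ n : saturated Q (J n).
  move=> s x nQs [k [t [nQt h]]]; exists k, (t * s); split; first exact: prime_compl.
  by have -> : t * s * u ^+ k * x = t * u ^+ k * (s * x) by ring.
(* Cancelling [u] is the purpose of the powers of [u] in [J]: it brings the remainder back into
   [J N] when Nakayama's lemma is applied. *)
have uJ n x : J n (u * x) -> J n x.
  move=> [k [t [nQt h]]]; exists k.+1, t; split=> //.
  by have -> : t * u ^+ k.+1 * x = t * u ^+ k * (u * x) by rewrite exprS; ring.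
have Janti n : sub_ideal (J n.+1) (J n).
  move=> x [k [s [nQs [a [r [P0a e]]]]]]; exists k, s; split=> //.
  by exists a, (r * y); split=> //; rewrite e exprS; ring.
have P0J n : sub_ideal P0 (J n).
  move=> x P0x; exists 0%N, 1; split; first exact: hQ.2.1.
  by rewrite expr0 !mul1r; exact: sub_adjoin.
have [n|N hN] := saturated_dcc noeR hQ (adjoin_ideal u iP0) minQ
    (L := fun n => saturation Q (adjoin (J n) u)).
  have hJu := adjoin_ideal u (hJ n); split.
  - exact: saturation_ideal.
  - exact: saturation_saturated.
  - move=> _ [a [r [P0a ->]]]; apply: sub_saturation => //; exists a, r.
    by split=> //; exact: P0J.
  - move=> x [s nQs [a [r [Ja e]]]]; exists s => //; exists a, r.
    by split=> //; exact: Janti.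
have JN : sub_ideal (J N) (J N.+1).
  apply: (saturated_nakayama noeR hQ _ _ _ _ _ Qu) => // z Jz.
  have [|s nQs [a [r [Ja e]]]] := hN N (leqnn N) z.
    by apply: sub_saturation => //; exact: sub_adjoin.
  exists s, a, r; split=> //; last by rewrite e mulrC.
  apply: uJ; have -> : u * r = s * z - a by rewrite e; ring.
  by apply: idealB; [| exact: ideal_mull | exact: Janti].
have [|k [s [nQs [a [r [P0a e]]]]]] := JN (y ^+ N).
  exists 0%N, 1; split; first exact: hQ.2.1.
  by rewrite expr0 !mul1r; exact: mem_adjoin.
(* As [y] is outside [P0], the other factor is in [P0], hence in [P1]; since [y] is in [P1], so is
   [s * u ^+ k], although neither [s] nor [u] is. *)
have : P0 (y ^+ N * (s * u ^+ k - r * y)).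
  suff -> : y ^+ N * (s * u ^+ k - r * y) = a by [].
  have -> : a = s * u ^+ k * y ^+ N - r * y ^+ N.+1 by rewrite e; ring.
  by rewrite exprS; ring.
move=> /hP0.2.2[/(prime_exp hP0) //|/s01' h].
have : P1 (s * u ^+ k).
  have -> : s * u ^+ k = (s * u ^+ k - r * y) + r * y by ring.
  by apply: idealD => //; [exact: hP1.1 | apply: ideal_mull => //; exact: hP1.1].
by move=> /hP1.2.2[/s1Q.1 //|/(prime_exp hP1)].
Qed.

End PrincipalIdealTheorem.

(** * Chains of primes, and why regular local rings are domains *)

Section RegularLocalDomain.
Variable R : comNzRingType.
Implicit Types (I J K P Q m : R -> Prop) (c : nat -> R -> Prop).

Lemma strict_sub_trans P Q J :
  strict_sub P Q -> sub_ideal Q J -> strict_sub P J.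
Proof.
by move=> [sPQ [x [Qx nPx]]] sQJ; split=> [y /sPQ /sQJ //|]; exists x; split=> //; exact: sQJ.
Qed.

Lemma prime_chain_rcons c n P : prime_chain c n -> prime_ideal P ->
  strict_sub (c n) P ->
  prime_chain (fun i => if (i <= n)%N then c i else P) n.+1.
Proof.
move=> [pc sc] pP sP; split=> i; first by case: ifP => // /pc.
rewrite ltnS /=; case: (ltngtP i n) => // [lt _|-> //]; exact: sc.
Qed.

Lemma prime_chain_cons c n P : prime_chain c n -> prime_ideal P ->
  strict_sub P (c 0%N) ->
  prime_chain (fun i => if i is j.+1 then c j else P) n.+1.
Proof.
by move=> [pc sc] pP sP; split=> [[|i]|[|i]] //; [exact: pc | exact: sc].
Qed.

Lemma prime_chain_belast c n : prime_chain c n.+1 -> prime_chain c n.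
Proof.
by move=> [pc sc]; split=> i le; [exact/pc/leqW | exact/sc/leqW].
Qed.

Lemma prime_chain_behead c n :
  prime_chain c n.+1 -> prime_chain (fun i => c i.+1) n.
Proof. by move=> [pc sc]; split=> i le; [exact: pc | exact: sc]. Qed.

(** The principal ideal theorem replaces the prime just below the top by one containing [x];
    induction then treats the chain ending there. Keeping the top prime fixed lets the old top be
    put back. *)
Lemma prime_chain_through c n x : noetherian R ->
  prime_chain c n.+1 -> c n.+1 x ->
  exists c', [/\ prime_chain c' n.+1, c' 0%N = c 0%N, c' n.+1 = c n.+1 & c' 1%N x].
Proof.
move=> noeR; elim: n c => [|n IH] c hc cx; first by exists c.
have [pc sc] := hc.
have [P [pP sP Ps Px]] := krull_principal_ideal noeR (pc n (leqW (leqnSn _)))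
  (pc n.+1 (leqnSn _)) (pc n.+2 (leqnn _)) (sc n (leqnSn _)) (sc n.+1 (leqnn _)) cx.
pose d i := if (i <= n)%N then c i else P.
have hd : prime_chain d n.+1.
  by apply: prime_chain_rcons => //; do 2!apply: prime_chain_belast.
have [|d' [hd' d'0 d'n d'1]] := IH d hd; first by rewrite /d ltnn.
exists (fun i => if (i <= n.+1)%N then d' i else c n.+2); split=> //.
- apply: prime_chain_rcons => //; first exact: pc.
  by rewrite d'n /d ltnn.
- by rewrite ltnn.
Qed.

Lemma local_prime m : local_ring_with m -> prime_ideal m.
Proof.
move=> [hm [m1 um]]; split=> //; split=> // x y mxy.
apply: contrapT => /not_orP[/um[x' ex] /um[y' ey]]; apply: m1.
have -> : 1 = x' * y' * (x * y) by rewrite -[1]mulr1 -{1}ex -ey; ring.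
exact: ideal_mull.
Qed.

Lemma prime_sub_local m P : local_ring_with m -> prime_ideal P -> sub_ideal P m.
Proof.
move=> [hm [m1 um]] [hP [P1 _]] x Px; apply: contrapT => /um[y e].
by apply: P1; rewrite -e; exact: ideal_mulr.
Qed.

(** Elements outside [m] are units, so every ideal is saturated with respect to [m]. *)
Lemma local_nakayama m I J u : noetherian R -> local_ring_with m ->
  is_ideal I -> is_ideal J -> sub_ideal I J -> m u ->
  (forall z, J z -> exists a r, [/\ I a, J r & z = a + u * r]) ->
  sub_ideal J I.
Proof.
move=> noeR hm hI hJ sIJ mu h.
have satm K : is_ideal K -> saturated m K.
  move=> hK s x /hm.2.2[t e] Ksx.
  have -> : x = t * (s * x) by rewrite mulrA (mulrC t) e mul1r.
  exact: ideal_mull.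
apply: (saturated_nakayama noeR (local_prime hm) hI hJ (satm _ hI) (satm _ hJ) sIJ mu).
move=> z /h[a [r [Ia Jr e]]]; exists 1, a, r; split=> //; last by rewrite mul1r.
exact: hm.2.1.
Qed.

(** Generation of [m] by [s] modulo [I] is expressed through ideals instead of linear combinations,
    which makes moving an element from [s] to [I] immediate. *)
Definition generated_mod m I (s : seq R) : Prop :=
  (forall x, x \in s -> m x) /\
  forall J, is_ideal J -> sub_ideal I J -> (forall x, x \in s -> J x) -> sub_ideal m J.

Lemma generated_mod_cons m I x s : generated_mod m I (x :: s) -> is_ideal I ->
  generated_mod m (adjoin I x) s.
Proof.
move=> [sm gen] hI; split=> [y ys|J hJ sIJ sJ]; first by apply: sm; rewrite inE ys orbT.
apply: gen => // [y Iy|y]; first by apply: sIJ; exact: sub_adjoin.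
by rewrite inE => /predU1P[->|/sJ //]; apply: sIJ; exact: mem_adjoin.
Qed.

(** Replacing the top prime by [m], which contains every prime, puts [x] in the top of the chain. *)
Lemma prime_chain_through_local m c n x : noetherian R -> local_ring_with m ->
  prime_chain c n.+1 -> m x ->
  exists c', [/\ prime_chain c' n.+1, c' 0%N = c 0%N & c' 1%N x].
Proof.
move=> noeR hm hc mx; pose d i := if (i <= n)%N then c i else m.
have hd : prime_chain d n.+1.
  apply: prime_chain_rcons; [exact: prime_chain_belast|exact: local_prime|].
  apply: strict_sub_trans (hc.2 n (leqnn _)) _.
  by apply: prime_sub_local => //; exact: hc.1.
have [|c' [hc' c'0 _ c'1]] := prime_chain_through noeR hd (x := x).
  by rewrite /d ltnn.
by exists c'.
Qed.

(** Once [x] lies in the second prime, dropping the first leaves a chain over [I + (x)] that is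
    shorter by one. With [s] empty, [I] contains [m] and no strict step remains. *)
Lemma krull_height m I s c : noetherian R -> local_ring_with m ->
  is_ideal I -> generated_mod m I s -> sub_ideal I (c 0%N) ->
  ~ prime_chain c (size s).+1.
Proof.
move=> noeR hm; elim: s I c => [|x s IH] I c hI gen sIc hc.
  have [_ [x [c1x nc0x]]] := hc.2 0%N (leqnn _); apply: nc0x.
  apply: sIc; apply: gen.2 => //.
  by apply: (prime_sub_local hm) c1x; exact: hc.1.
have mx : m x by apply: gen.1; rewrite inE eqxx.
have [c' [hc' c'0 c'1x]] := prime_chain_through_local noeR hm hc mx.
have hc'1 := hc'.1 1%N isT.
apply: (IH (adjoin I x) (fun i => c' i.+1)) (prime_chain_behead hc').
- exact: adjoin_ideal.
- exact: generated_mod_cons.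
- apply: adjoin_min => //; first exact: hc'1.1.
  by move=> y /sIc; rewrite -c'0 => /(hc'.2 0%N isT).1.
Qed.

(** By induction [I + (x)] is prime. The height bound forces it to equal [c' 1] and keeps [x] out of
    [c' 0]. An element [a + r * x] of [c' 0] with [a] in [I] then has [r] in [c' 0], and Nakayama's
    lemma gives [I = c' 0]. *)
Lemma regular_mod_prime m I s c : noetherian R -> local_ring_with m ->
  is_ideal I -> generated_mod m I s -> sub_ideal I (c 0%N) ->
  prime_chain c (size s) -> prime_ideal I.
Proof.
move=> noeR hm; elim: s I c => [|x s IH] I c hI gen sIc hc.
  suff -> : I = c 0%N by exact: hc.1.
  apply/seteqP; split=> // x c0x; apply: gen.2 => //.
  by apply: (prime_sub_local hm) c0x; exact: hc.1.
have mx : m x by apply: gen.1; rewrite inE eqxx.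
have [c' [hc' c'0 c'1x]] := prime_chain_through_local noeR hm hc mx.
have hc'1 := hc'.1 1%N isT; have hc'0 := hc'.1 0%N isT.
have hIx := adjoin_ideal x hI; have gen' := generated_mod_cons gen hI.
rewrite -c'0 in sIc.
have sIxc' : sub_ideal (adjoin I x) (c' 1%N).
  apply: adjoin_min => //; first exact: hc'1.1.
  by move=> y /sIc /(hc'.2 0%N isT).1.
have pIx : prime_ideal (adjoin I x) := IH _ _ hIx gen' sIxc' (prime_chain_behead hc').
have sc'Ix : sub_ideal (c' 1%N) (adjoin I x).
  move=> y c'y; apply: contrapT => nIxy.
  pose d i := if i is j.+1 then c' j.+1 else adjoin I x.
  apply: (@krull_height m (adjoin I x) s d) => //.
  apply: (@prime_chain_cons (fun j => c' j.+1)) => //; first exact: prime_chain_behead.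
  by split=> //; exists y.
have nc'0x : ~ c' 0%N x.
  move=> c'x; apply: (@krull_height m (adjoin I x) s c') => //.
  by apply: adjoin_min => //; exact: hc'0.1.
suff -> : I = c' 0%N by [].
apply/seteqP; split=> //; apply: (local_nakayama noeR hm) mx _ => //; first exact: hc'0.1.
move=> z c'z; have /sc'Ix[a [r [Ia e]]] := (hc'.2 0%N isT).1 _ c'z.
exists a, r; split=> //; last by rewrite e mulrC.
have : c' 0%N (r * x).
  have -> : r * x = z - a by rewrite e; ring.
  by apply: idealB => //; [exact: hc'0.1 | exact: sIc].
by move=> /hc'0.2.2[].
Qed.

Lemma regular_local_domain m : noetherian R -> local_ring_with m ->
  regular_local m -> forall x y : R, x * y = 0 -> x = 0 \/ y = 0.
Proof.
move=> noeR hm [d [[[c hc] _] [s [sz gen]]]].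
have h0 : is_ideal (fun x : R => x = 0).
  by split=> //; split=> [x y -> ->|a x ->]; rewrite ?addr0 ?mulr0.
suff [_ [_ h]] : prime_ideal (fun x : R => x = 0) by exact: h.
apply: (regular_mod_prime (m := m) (s := s) (c := c)) => //; last by rewrite sz.
  split=> [x xs|J hJ _ sJ x /gen]; first by apply/gen/mem_ideal_gen.
  exact: ideal_gen_min.
by move=> x ->; apply: ideal0; exact: (hc.1 0%N isT).1.
Qed.

End RegularLocalDomain.

(** * Monic polynomials of a given degree *)

Section MonicPolynomials.
Variable R : comNzRingType.
Implicit Types (p q : {poly R}).

Lemma monic_of_coef p n :
  (size p <= n.+1)%N -> p`_n = 1 -> p \is monic /\ size p = n.+1.
Proof.
move=> sp pn; have sz : size p = n.+1.
  apply/eqP; rewrite eqn_leq sp ltnNge; apply/negP => le.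
  by move: pn; rewrite nth_default // => /esym/eqP; rewrite oner_eq0.
by split=> //; rewrite monicE lead_coefE sz /= pn.
Qed.

Lemma monic_coef p n : p \is monic -> size p = n.+1 -> p`_n = 1.
Proof. by move=> /monicP; rewrite lead_coefE => + sz; rewrite sz. Qed.

Lemma size_monicB p q n : p \is monic -> q \is monic ->
  size p = n.+1 -> size q = n.+1 -> (size (p - q)%R <= n)%N.
Proof.
move=> mp mq sp sq; apply/leq_sizeP => j; rewrite coefB leq_eqVlt.
move=> /predU1P[<-|lt]; first by rewrite (monic_coef mp sp) (monic_coef mq sq) subrr.
by rewrite !nth_default ?subrr // ?sp ?sq.
Qed.

Lemma monic_shift p (a : R) n : p \is monic -> size p = n.+1 ->
  p \Po ('X + a%:P) \is monic /\ size (p \Po ('X + a%:P)) = n.+1.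
Proof.
move=> mp sp; set r := p - 'X^n.
have sr : (size r <= n)%N.
  by apply: size_monicB => //; [exact: monicXn | rewrite size_polyXn].
have -> : p = 'X^n + r by rewrite /r addrC subrK.
have mX : ('X + a%:P) ^+ n \is monic by apply: monic_exp; exact: monicXaddC.
have sX : size (('X + a%:P) ^+ n) = n.+1.
  elim: (n) => [|k IH]; first by rewrite expr0 size_poly1.
  rewrite exprS size_Mmonic ?monic_exp ?monicXaddC ?monic_neq0 ?monicXaddC //.
  by rewrite IH size_XaddC.
have sc : (size (r \Po ('X + a%:P)) <= n)%N.
  have [->|rn0] := eqVneq r 0; first by rewrite comp_poly0 size_poly0.
  apply: leq_trans (size_comp_poly_leq _ _) _.
  by rewrite size_XaddC muln1 prednK // lt0n size_poly_eq0.
rewrite comp_polyD rmorphXn /= comp_polyX; split; last by rewrite size_polyDl sX.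
by rewrite monicE lead_coefDl ?sX // -monicE.
Qed.

End MonicPolynomials.

(** * Powers of [m], Hensel's lemma, and translates of integral elements *)

Section Hensel.
Variable R : comNzRingType.
Implicit Types (I m : R -> Prop) (F G H : {poly R}).

Lemma ideal_powS m n x : ideal_pow m n.+1 x <->
  exists2 s : seq (R * R), (forall p, p \in s -> m p.1 /\ ideal_pow m n p.2) &
    x = \sum_(p <- s) p.1 * p.2.
Proof.
split=> [[s [hs e]]|[s hs e]]; exists s => //.
  by move=> p /(nthP (0, 0))[i lt <-]; exact: hs.
by split=> // i lt; apply/hs/mem_nth.
Qed.

Lemma ideal_pow_ideal m n : is_ideal m -> is_ideal (ideal_pow m n).
Proof.
move=> hm; elim: n => [//|n IH]; split; first by apply/ideal_powS; exists [::]; rewrite ?big_nil.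
split=> [x y /ideal_powS[s hs ->] /ideal_powS[t ht ->]|a x /ideal_powS[s hs ->]];
  apply/ideal_powS.
  exists (s ++ t); last by rewrite big_cat.
  by move=> p; rewrite mem_cat => /orP[/hs|/ht].
exists [seq (a * p.1, p.2) | p <- s].
  by move=> _ /mapP[p /hs[m1 m2] ->]; split=> //; exact: ideal_mull.
by rewrite big_map mulr_sumr; apply: eq_bigr => p _; rewrite mulrA.
Qed.

Lemma ideal_powM m n x y : m x -> ideal_pow m n y -> ideal_pow m n.+1 (x * y).
Proof.
move=> mx my; apply/ideal_powS; exists [:: (x, y)]; last by rewrite big_seq1.
by move=> p; rewrite inE => /eqP ->.
Qed.

Lemma ideal_pow_sub m n : is_ideal m -> sub_ideal (ideal_pow m n.+1) (ideal_pow m n).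
Proof.
move=> hm x /ideal_powS[s hs ->]; rewrite big_seq.
have := ideal_pow_ideal n hm.
by move=> hn; apply: ideal_sum => // p /hs[_]; exact: ideal_mull.
Qed.

Lemma ideal_pow1 m : is_ideal m -> ideal_pow m 1 = m.
Proof.
move=> hm; apply/seteqP; split=> x.
  move=> /ideal_powS[s hs ->]; rewrite big_seq.
  by apply: ideal_sum => // p /hs[mp _]; exact: ideal_mulr.
by move=> mx; rewrite -[x]mulr1; exact: ideal_powM.
Qed.

Lemma ideal_pow_anti m (p q : nat) : is_ideal m -> (p <= q)%N ->
  sub_ideal (ideal_pow m q) (ideal_pow m p).
Proof.
move=> hm /subnK <-; elim: (q - p)%N => [//|d IH] x.
by rewrite addSn => /(ideal_pow_sub hm); exact: IH.
Qed.

Definition coefs_in I (p : {poly R}) : Prop := forall i, I p`_i.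

Lemma coefs_in_ideal I : is_ideal I -> is_ideal (coefs_in I).
Proof.
move=> hI; split; first by move=> i; rewrite coef0; exact: ideal0.
split=> [p q hp hq i|a p hp i]; first by rewrite coefD; exact: idealD.
by rewrite coefM; apply: ideal_sum => // j _; exact: ideal_mull.
Qed.

Lemma coefs_in_powM m n p q : is_ideal m -> coefs_in m p ->
  coefs_in (ideal_pow m n) q -> coefs_in (ideal_pow m n.+1) (p * q).
Proof.
move=> hm hp hq i; rewrite coefM; apply: ideal_sum; first exact: ideal_pow_ideal.
by move=> j _; exact: ideal_powM.
Qed.

(** Induction on [e]: subtracting a multiple of [H] from [U] kills its constant term, so that
    another ['X] can be extracted. *)
Lemma coprime_Xn H e (t : R) : H`_0 * t = 1 -> exists U V : {poly R}, V * H + U * 'X^e = 1.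
Proof.
move=> ht; elim: e => [|e [U [V e1]]]; first by exists 1, 0; rewrite mul0r add0r mul1r expr0.
pose c := U`_0 * t; pose W := drop_poly 1 (U - c%:P * H).
have eW : W * 'X = U - c%:P * H.
  rewrite -[RHS](poly_take_drop 1) -/W expr1.
  suff -> : take_poly 1 (U - c%:P * H) = 0 by rewrite add0r.
  apply/polyP => i; rewrite coef_take_poly coef0; case: i => [|i] //=.
  by rewrite coefB coefCM /c -mulrA (mulrC t) ht mulr1 subrr.
exists W, (V + c%:P * 'X^e).
have -> : (V + c%:P * 'X^e) * H + W * 'X^(e.+1) =
  V * H + c%:P * H * 'X^e + W * 'X * 'X^e by rewrite exprS; ring.
by rewrite eW -e1; ring.
Qed.


(** The Bezout relation between ['X^e] and [H0] serves at every stage. Dividing [V * D] by ['X^e]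
    gives [D = dG * H0 + dH * 'X^e] with the right degrees, and each term of the new error is a
    product of a factor over [m] and one over [m^(n+1)]. *)
Lemma hensel_step m n e h F G H H0 (t : R) : is_ideal m ->
  H0`_0 * t = 1 -> H0 \is monic -> size H0 = h.+1 ->
  F \is monic -> size F = (e + h).+1 ->
  G \is monic -> size G = e.+1 -> H \is monic -> size H = h.+1 ->
  coefs_in m (G - 'X^e) -> coefs_in m (H - H0) ->
  coefs_in (ideal_pow m n.+1) (F - G * H) ->
  exists dG dH : {poly R}, [/\ (size dG <= e)%N, (size dH <= h)%N,
    coefs_in (ideal_pow m n.+1) dG, coefs_in (ideal_pow m n.+1) dH &
    coefs_in (ideal_pow m n.+2) (F - (G + dG) * (H + dH))].
Proof.
move=> hm ht mH0 sH0 mF sF mG sG mH sH cG cH cD.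
have hpow := ideal_pow_ideal n.+1 hm; have hcp := coefs_in_ideal hpow.
have [U [V eUV]] := coprime_Xn e ht.
set D := F - G * H in cD *.
pose dG := take_poly e (V * D).
pose dH := D * U + drop_poly e (V * D) * H0.
have cdG : coefs_in (ideal_pow m n.+1) dG.
  move=> i; rewrite coef_take_poly; case: ifP => _; last exact: ideal0.
  exact: (ideal_mull V hcp cD).
have cdH : coefs_in (ideal_pow m n.+1) dH.
  apply: (idealD hcp); first exact: (ideal_mulr U hcp cD).
  apply: (ideal_mulr H0 hcp) => i; rewrite coef_drop_poly.
  exact: (ideal_mull V hcp cD).
have eD : D - dG * H0 = dH * 'X^e.
  have e1 : V * D = dG + drop_poly e (V * D) * 'X^e by rewrite poly_take_drop.
  have e2 : dG = V * D - drop_poly e (V * D) * 'X^e by rewrite {1}e1; ring.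
  have -> : D - dG * H0 = D * (1 - V * H0) + drop_poly e (V * D) * 'X^e * H0.
    by rewrite e2; ring.
  by rewrite -eUV /dH; ring.
have sdG : (size dG <= e)%N by exact: size_take_poly.
have sGH : size (G * H) = (e + h).+1.
  by rewrite size_Mmonic // ?monic_neq0 // sG sH addSn addnS.
have sD : (size D <= e + h)%N by apply: size_monicB => //; rewrite monicMl.
have sdH : (size dH <= h)%N.
  have [->|dH0] := eqVneq dH 0; first by rewrite size_poly0.
  rewrite -(leq_add2l e) -size_mulXn // -eD.
  apply: leq_trans (size_polyD _ _) _; rewrite size_polyN geq_max sD /=.
  have [->|dG0] := eqVneq dG 0; first by rewrite mul0r size_poly0.
  by rewrite size_Mmonic // sH0 addnS /= leq_add2r.
exists dG, dH; split=> //.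
have -> : F - (G + dG) * (H + dH) =
  - ((H - H0) * dG + (G - 'X^e) * dH + dG * dH).
  have -> : F = dH * 'X^e + dG * H0 + G * H by rewrite -eD /D; ring.
  by ring.
have hcp2 := coefs_in_ideal (ideal_pow_ideal n.+2 hm).
apply: (idealN hcp2); apply: (idealD hcp2); first apply: (idealD hcp2).
- exact: coefs_in_powM.
- exact: coefs_in_powM.
- apply: coefs_in_powM => // i; rewrite -(ideal_pow1 hm).
  by apply: ideal_pow_anti (cdG i).
Qed.

Lemma poly_limit m (P : nat -> {poly R}) N : is_ideal m -> madic_complete m ->
  (forall n, size (P n) <= N)%N ->
  (forall n, coefs_in (ideal_pow m n) (P n.+1 - P n)) ->
  exists2 L : {poly R}, (size L <= N)%N &
    forall n, coefs_in (ideal_pow m n) (L - P n).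
Proof.
move=> hm [_ compl] sP cP.
have step n d i : ideal_pow m n ((P (n + d)%N)`_i - (P n)`_i).
  have hn := ideal_pow_ideal n hm.
  elim: d => [|d IH]; first by rewrite addn0 subrr; exact: ideal0.
  rewrite addnS -(subrK (P (n + d)%N)`_i (P (n + d).+1)`_i) -addrA.
  apply: idealD => //; rewrite -coefB.
  by apply: (ideal_pow_anti hm (leq_addr d n)); exact: cP.
have lim i : exists l, forall n, ideal_pow m n (l - (P n)`_i).
  have [k|l hl] := compl (fun n => (P n)`_i).
    exists k => p q kp kq; have hk := ideal_pow_ideal k hm.
    have -> : (P p)`_i - (P q)`_i = ((P p)`_i - (P k)`_i) - ((P q)`_i - (P k)`_i).
      by ring.
    by rewrite -{1}(subnKC kp) -{1}(subnKC kq); exact: idealB.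
  (* Passing through the term [n + M] gives the congruence at [n] itself, not only at large
     indices. *)
  exists l => n; have [M hM] := hl n; have hn := ideal_pow_ideal n hm.
  have -> : l - (P n)`_i =
      ((P (n + M)%N)`_i - (P n)`_i) - ((P (n + M)%N)`_i - l) by ring.
  by apply: idealB => //; apply: hM; exact: leq_addl.
have [l hl] := choice lim.
exists (\poly_(i < N) l i); first exact: size_poly.
move=> n i; rewrite coefB coef_poly; case: ltnP => // Ni.
rewrite nth_default ?subrr; last exact: leq_trans (sP n) Ni.
by apply: ideal0; exact: ideal_pow_ideal.
Qed.

Lemma hensel_Xn m e h F H0 (t : R) : is_ideal m -> madic_complete m ->
  H0`_0 * t = 1 -> H0 \is monic -> size H0 = h.+1 ->
  F \is monic -> size F = (e + h).+1 -> coefs_in m (F - 'X^e * H0) ->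
  exists G H, [/\ F = G * H, G \is monic /\ size G = e.+1,
    H \is monic /\ size H = h.+1 & coefs_in m (G - 'X^e)].
Proof.
move=> hm compl ht mH0 sH0 mF sF cF.
have hcm := coefs_in_ideal hm.
pose inv n (z : {poly R} * {poly R}) :=
  [/\ z.1 \is monic /\ size z.1 = e.+1, z.2 \is monic /\ size z.2 = h.+1,
      coefs_in m (z.1 - 'X^e), coefs_in m (z.2 - H0) &
      coefs_in (ideal_pow m n.+1) (F - z.1 * z.2)].
(* The step function is total: pairs that violate the invariant are returned unchanged. *)
have /choice[nxt hnxt] (nz : nat * ({poly R} * {poly R})) : exists z',
    inv nz.1 nz.2 -> [/\ inv nz.1.+1 z',
      coefs_in (ideal_pow m nz.1.+1) (z'.1 - nz.2.1) &
      coefs_in (ideal_pow m nz.1.+1) (z'.2 - nz.2.2)].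
  case: nz => n [G H] /=; have [[]|ninv] := pselect (inv n (G, H)); last by exists (G, H).
  move=> /= [mG sG] [mH sH] cG cH cD.
  have [dG [dH [sdG sdH cdG cdH cD']]] :=
    hensel_step hm ht mH0 sH0 mF sF mG sG mH sH cG cH cD.
  have pow_m p : coefs_in (ideal_pow m n.+1) p -> coefs_in m p.
    by move=> cp i; rewrite -(ideal_pow1 hm); apply: ideal_pow_anti (cp i).
  have addM (p d : {poly R}) k : p \is monic -> size p = k.+1 -> (size d <= k)%N ->
      p + d \is monic /\ size (p + d) = k.+1.
    move=> mp sp sd; split; last by rewrite size_polyDl // sp.
    by rewrite monicE lead_coefDl ?sp // -monicE.
  exists (G + dG, H + dH) => _ /=; split.
  - split=> //=; [exact: addM | exact: addM | | ].
      by rewrite addrAC; apply: (idealD hcm) => //; exact: pow_m.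
    by rewrite addrAC; apply: (idealD hcm) => //; exact: pow_m.
  - by rewrite addrAC subrr add0r.
  - by rewrite addrAC subrr add0r.
pose z := fix z n := if n is k.+1 then nxt (k, z k) else ('X^e, H0).
have invz n : inv n (z n).
  elim: n => [|n IH]; last by have [] := hnxt (n, z n) IH.
  split=> //; [by rewrite monicXn size_polyXn | | | ].
  - by rewrite subrr; exact: ideal0.
  - by rewrite subrr; exact: ideal0.
  - by rewrite ideal_pow1.
have cz1 n : coefs_in (ideal_pow m n) ((z n.+1).1 - (z n).1).
  by have [_ c _] := hnxt (n, z n) (invz n); move=> i; apply: ideal_pow_sub (c i).
have cz2 n : coefs_in (ideal_pow m n) ((z n.+1).2 - (z n).2).
  by have [_ _ c] := hnxt (n, z n) (invz n); move=> i; apply: ideal_pow_sub (c i).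
have [|G sG cG] := poly_limit (N := e.+1) hm compl _ cz1.
  by move=> n; have [[_ ->]] := invz n.
have [|H sH cH] := poly_limit (N := h.+1) hm compl _ cz2.
  by move=> n; have [_ [_ ->]] := invz n.
(* Leading coefficients survive the limit, since the powers of [m] intersect in 0. *)
have lim_coef (P : nat -> {poly R}) (L : {poly R}) k :
    (forall n, P n \is monic /\ size (P n) = k.+1) ->
    (forall n, coefs_in (ideal_pow m n) (L - P n)) -> L`_k = 1.
  move=> hP hL; apply/eqP; rewrite -subr_eq0; apply/eqP; apply: compl.1 => n.
  by have [mP sP] := hP n; rewrite -(monic_coef mP sP) -coefB; exact: hL.
exists G, H; split.
- apply/eqP; rewrite -subr_eq0; apply/eqP/polyP => i; rewrite coef0.
  apply: compl.1 => n; move: i; have hn := coefs_in_ideal (ideal_pow_ideal n hm).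
  have -> : F - G * H = (F - (z n).1 * (z n).2) - (G - (z n).1) * H
    - (H - (z n).2) * (z n).1 by ring.
  apply: (idealB hn); first apply: (idealB hn).
  + by have [_ _ _ _ c] := invz n; move=> i; apply: ideal_pow_sub (c i).
  + exact: (ideal_mulr H hn (cG n)).
  + exact: (ideal_mulr (z n).1 hn (cH n)).
- apply: monic_of_coef => //; apply: lim_coef cG => n.
  by have [] := invz n.
- apply: monic_of_coef => //; apply: lim_coef cH => n.
  by have [] := invz n.
(* The term of index 1 is compared, because the limit agrees with the term of index [n] only modulo
   [m^n]. *)
- have [_ _ c _ _] := invz 1%N.
  have -> : G - 'X^e = (G - (z 1%N).1) + ((z 1%N).1 - 'X^e) by ring.
  by apply: (idealD hcm) => // i; rewrite -(ideal_pow1 hm); exact: cG.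
Qed.

(* A root [a] modulo [m] of an equation of [s] is split off by Hensel's lemma;
   as [S] is a domain, one of the two factors kills [s]. *)
Lemma integral_translate m (S : comNzRingType) (f : {rmorphism R -> S}) :
  local_ring_with m -> madic_complete m -> residue_alg_closed m ->
  (forall x y : S, x * y = 0 -> x = 0 \/ y = 0) ->
  forall s, integralOver f s ->
  exists c (q : {poly R}) n, [/\ q \is monic, size q = n.+2,
    (map_poly f q).[s - f c] = 0 & forall i, (i <= n)%N -> m q`_i].
Proof.
move=> hm compl algc domS s [p mp]; move: s.
have [hmi [m1 um]] := hm.
have [k] := ubnP (size p); elim: k p mp => // k IH p mp szp s /rootP ps.
have sp : (1 < size p)%N.
  rewrite ltnNge; apply/negP => le; move: ps; rewrite (size1_polyC le).
  have : size p = 1%N by apply/eqP; rewrite eqn_leq le lt0n size_poly_eq0 monic_neq0.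
  move=> /(monic_coef mp) ->; rewrite map_polyC hornerC /= rmorph1 => /eqP.
  by rewrite oner_eq0.
have [a ma] := algc p mp sp.
case sz : (size p) sp => [//|[//|n]] _.
have [mF sF] := monic_shift a mp sz; set F := p \Po _ in mF sF.
have F0 : m F`_0 by rewrite -horner_coef0 horner_comp hornerD hornerX hornerC add0r.
have Fs : (map_poly f F).[s - f a] = 0.
  rewrite map_comp_poly horner_comp rmorphD /= map_polyX map_polyC.
  by rewrite hornerD hornerX hornerC /= subrK.
(* Let [e] be the least index of a coefficient of [F] outside [m]; the leading coefficient provides
   one. *)
have exe : exists e, `[< ~ m F`_e >].
  by exists n.+1; apply/asboolP; rewrite (monic_coef mF sF).
case: (ex_minnP exe) => e /asboolP nme mine.
have lte i : (i < e)%N -> m F`_i.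
  by move=> lt; apply: contrapT => nm; have := mine i (asboolT nm); rewrite leqNgt lt.
have e0 : (0 < e)%N by case: e nme {mine lte}.
have len : (e <= n.+1)%N by apply: mine; apply/asboolP; rewrite (monic_coef mF sF).
(* If [e] is the degree, [F] is already as required. Otherwise [F] is ['X^e * H0] modulo [m], where
   [H0] has unit constant term, and Hensel's lemma factors it. *)
move: len; rewrite leq_eqVlt => /predU1P[een|ltn].
  by exists a, F, n; split=> // i le; apply: lte; rewrite een.
have [t ht] := um _ nme.
pose h := (n.+1 - e)%N; pose H0 := drop_poly e F.
have eh : (e + h = n.+1)%N by rewrite subnKC // ltnW.
have [mH0 sH0] : H0 \is monic /\ size H0 = h.+1.
  apply: monic_of_coef; first by rewrite size_drop_poly sF subSn // ltnW.
  by rewrite coef_drop_poly addnC eh (monic_coef mF sF).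
have [|||G [H [FGH [mG sG] [mH sH] cG]]] :=
    @hensel_Xn m e h F H0 t hmi compl _ mH0 sH0 mF.
- by rewrite coef_drop_poly add0n.
- by rewrite eh.
- move=> i; rewrite -{1}(poly_take_drop e F) mulrC addrK coef_take_poly.
  by case: ifP => [/lte //|_]; exact: ideal0.
(* If [G] vanishes at [s - f a], it is the polynomial sought, being ['X^e] modulo [m]. Otherwise
   [H], of smaller degree, does, and the two translations add up. *)
move: Fs; rewrite FGH rmorphM hornerM => /domS[Gs|Hs].
  exists a, G, e.-1; split=> //; first by rewrite prednK.
  move=> i; rewrite -ltnS prednK // => lt.
  by have := cG i; rewrite coefB coefXn ltn_eqF // subr0.
have [||c [q [n' [mq sq qs mqi]]]] := IH H mH _ (s - f a); last first.
- exists (a + c), q, n'; split=> //.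
  by rewrite rmorphD opprD addrA.
- exact/rootP.
- by rewrite sH; move: szp; rewrite sz; lia.
Qed.

End Hensel.

(** * Quotient rings and maps out of them *)

Lemma quotient_ring (A : comNzRingType) (I : A -> Prop) :
  is_ideal I -> ~ I 1 ->
  exists (Q : comNzRingType) (pi : {rmorphism A -> Q}),
    (forall y, exists x, pi x = y) /\ (forall x, pi x = 0 <-> I x).
Proof.
move=> hI nI1; pose S : A -> bool := fun x => `[< I x >].
have hS : idealr_closed S.
  split; first by apply/asboolP; exact: ideal0.
    by apply/asboolP.
  move=> a x y /asboolP Ix /asboolP Iy; apply/asboolP.
  by apply: idealD => //; exact: ideal_mull.
pose idS : idealr A := HB.pack S (isIdealr.Build A S hS).
pose pi : {rmorphism A -> {ideal_quot idS}} := (\pi_{ideal_quot idS})%qT.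
have pi0 x : pi x = 0 <-> x \in idS.
  have -> : (x \in idS) = (pi x == pi 0) by rewrite -{1}[x]subr0 Quotient.idealrBE.
  by rewrite rmorph0; split=> [/eqP|/eqP].
exists {ideal_quot idS}, pi; split=> [y|x]; first by exists (repr y); exact: reprK.
by rewrite pi0; split=> [/asboolP|Ix] //; apply/asboolP.
Qed.

Lemma quotient_lift (A B Q : comNzRingType) (pi : {rmorphism A -> Q})
  (phi : {rmorphism A -> B}) : (forall y, exists x, pi x = y) ->
  (forall x, pi x = 0 -> phi x = 0) ->
  exists h : {rmorphism Q -> B}, forall x, h (pi x) = phi x.
Proof.
move=> /choice[sec secK] ker; pose h y := phi (sec y).
have hpi x : h (pi x) = phi x.
  by apply/eqP; rewrite -subr_eq0 -rmorphB ker // rmorphB secK subrr.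
have hB : zmod_morphism h.
  by move=> x y; rewrite -(secK x) -(secK y) -rmorphB !hpi rmorphB.
have hM : monoid_morphism h.
  split; first by rewrite -(rmorph1 pi) hpi rmorph1.
  by move=> x y; rewrite -(secK x) -(secK y) -rmorphM !hpi rmorphM.
pose h' : {rmorphism Q -> B} := HB.pack h
  (GRing.isZmodMorphism.Build Q B h hB) (GRing.isMonoidMorphism.Build Q B h hM).
by exists h'.
Qed.

(** * Existence of the ring [T] attached to monic polynomials *)

Section PolyQuotient.
Variable R : comNzRingType.

(** One variable at a time: with [T1] built for the other polynomials, [T] is [T1[X]] modulo the
    first, which is nonzero because that polynomial is monic of positive degree. Integrality is
    carried along for incomparability. *)
Lemma poly_quotient_exists r (F : 'I_r -> {poly R}) :
  (forall i, F i \is monic /\ (1 < size (F i))%N) ->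
  exists (T : comNzRingType) (g : {rmorphism R -> T}) (y : 'I_r -> T),
    is_poly_quotient F g y /\ integralRange g.
Proof.
elim: r F => [|r IH] F hF.
  exists R, idfun, (fun=> 0).
  split; last by move=> t; exact: (integral_id idfun).
  split=> [[]//|T' g' y' _]; split; first by exists g'; split=> // -[].
  by move=> h1 h2 e1 _ e2 _ t; rewrite e1 e2.
have [T1 [g1 [y1 [[y1F univ1] int1]]]] := IH (fun i => F (lift ord0 i)) (fun i => hF _).
have [mF0 sF0] := hF ord0; set F0 := F ord0 in mF0 sF0.
pose F1 := map_poly g1 F0.
have mF1 : F1 \is monic by exact: monic_map.
have sF1 : size F1 = size F0.
  by rewrite size_map_poly_id0 // (monicP mF0) rmorph1 oner_eq0.
pose I (p : {poly T1}) := exists q, p = q * F1.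
have hI : is_ideal I.
  split; first by exists 0; rewrite mul0r.
  split=> [_ _ [a ->] [b ->]|a _ [b ->]]; first by exists (a + b); rewrite mulrDl.
  by exists (a * b); rewrite mulrA.
have nI1 : ~ I 1.
  move=> [q e]; have q0 : q != 0.
    by apply/eqP => q0; move/eqP: e; rewrite q0 mul0r oner_eq0.
  have := congr1 (fun p : {poly _} => size p) e.
  rewrite size_poly1 size_Mmonic // sF1; move: q0; rewrite -size_poly_eq0; lia.
have [T [pi [pi_surj pi_ker]]] := quotient_ring hI nI1.
pose g : {rmorphism R -> T} := (pi \o (@polyC T1 \o g1))%FUN.
pose y (i : 'I_r.+1) := if unlift ord0 i is Some j then pi (y1 j)%:P else pi 'X.
have y0 : y ord0 = pi 'X by rewrite /y unlift_none.
have yS j : y (lift ord0 j) = pi (y1 j)%:P by rewrite /y liftK.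
have mapg (p : {poly R}) z : (map_poly g p).[pi z] = pi ((map_poly g1 p) \Po z).
  by rewrite /comp_poly -horner_map /= -!map_poly_comp.
have yF i : (map_poly g (F i)).[y i] = 0.
  case: (unliftP ord0 i) => [j ->|->].
    by rewrite yS mapg comp_polyCr y1F !rmorph0.
  by rewrite y0 mapg comp_polyXr; apply/pi_ker; exists 1; rewrite mul1r.
exists T, g, y; split; first split=> //.
  move=> T' g' y' y'F.
  have [[h1 [h1g h1y]] uniq1] := univ1 T' g' (fun j => y' (lift ord0 j)) (fun j => y'F _).
  split.
    pose phi : {rmorphism {poly T1} -> T'} :=
      (horner_eval (y' ord0) \o map_poly h1)%FUN.
    have phiE p : phi p = (map_poly h1 p).[y' ord0] by [].
    have [x /pi_ker[q ->]|h hpi] := @quotient_lift _ _ _ pi phi pi_surj.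
      rewrite rmorphM phiE phiE /F1 -map_poly_comp.
      by rewrite (eq_map_poly (g := g')) ?y'F ?mulr0 // => a; exact: h1g.
    exists h; split=> [a|i]; first by rewrite /g /= hpi phiE map_polyC hornerC /= h1g.
    case: (unliftP ord0 i) => [j ->|->].
      by rewrite yS hpi phiE map_polyC hornerC /= h1y.
    by rewrite y0 hpi phiE map_polyX hornerX.
  move=> k1 k2 k1g k1y k2g k2y t; have [p <-] := pi_surj t.
  (* Both maps restrict to [T1], where uniqueness holds by induction. *)
  have kC c : k1 (pi c%:P) = k2 (pi c%:P).
    pose l1 : {rmorphism T1 -> T'} := (k1 \o (pi \o @polyC T1))%FUN.
    pose l2 : {rmorphism T1 -> T'} := (k2 \o (pi \o @polyC T1))%FUN.
    have := uniq1 l1 l2; apply=> [a|j|a|j].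
    - exact: k1g.
    - by rewrite -k1y yS.
    - exact: k2g.
    - by rewrite -k2y yS.
  elim/poly_ind: p => [|p c IHp]; first by rewrite !rmorph0.
  by rewrite !(rmorphD, rmorphM) /= IHp kC -y0 k1y k2y.
have intX : integralOver g (pi 'X).
  by exists F0 => //; apply/rootP; rewrite -y0 yF.
move=> t; have [p <-] := pi_surj t.
elim/poly_ind: p => [|p c IHp]; first by rewrite rmorph0; exact: integral0.
rewrite rmorphD rmorphM; apply: integral_add; first exact: integral_mul.
have [q mq qc] := int1 c.
by exists q => //; apply/rootP; rewrite mapg comp_polyCr (rootP qc) !rmorph0.
Qed.

End PolyQuotient.

(** * Integrality of finite extensions, and incomparability of primes *)

Section IntegralExtensions.
Variables (R S : comNzRingType) (f : {rmorphism R -> S}).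

(** The determinant trick: if [M] describes multiplication by [x] on the generators, the determinant
    of [x - M] kills all of them, hence kills 1, and it is the value at [x] of the characteristic
    polynomial of [M]. *)
Lemma module_finite_integral : module_finite f -> integralRange f.
Proof.
move=> [s gen] x; pose n := size s.
have /choice[C hC] (j : 'I_n) : exists c : seq R, x * s`_j = \sum_(i < n) f c`_i * s`_i.
  exact: gen.
pose M : 'M[R]_n := \matrix_(j, k) (C j)`_k.
pose v : 'cV[S]_n := \col_j s`_j.
pose A := x%:M - map_mx f M.
have Av : A *m v = 0.
  apply/matrixP => j k; rewrite mulmxBl mul_scalar_mx !mxE hC.
  by apply/eqP; rewrite subr_eq0; apply/eqP; apply: eq_bigr => i _; rewrite !mxE.
have dv : \det A *: v = 0 by rewrite -mul_scalar_mx -mul_adj_mx -mulmxA Av mulmx0.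
have det0 : \det A = 0.
  have [c e] := gen 1; rewrite -[LHS]mulr1 e mulr_sumr big1 // => i _.
  have /matrixP/(_ i 0) := dv; rewrite !mxE mulrCA => ->.
  by rewrite mulr0.
exists (char_poly M); first exact: char_poly_monic.
apply/rootP; rewrite map_char_poly -[LHS]/(horner_eval x _) /char_poly -det_map_mx -det0.
congr (\det _); apply/matrixP => i j.
by rewrite !mxE /= /horner_eval hornerD hornerN hornerC hornerMn hornerX.
Qed.

(** If [p * 'X + c] takes a value in [Q] at [t], then [c] lies in [P], so it is 0; hence [t] or the
    value of the monic [p] at [t] lies in [Q], and the degree drops. *)
Lemma incomparable (P Q : S -> Prop) : integralRange f ->
  prime_ideal P -> prime_ideal Q -> sub_ideal Q P ->
  (forall x, P (f x) -> x = 0) -> sub_ideal P Q.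
Proof.
move=> intS [hP _] [hQ [Q1 pQ]] sQP P0 t Pt.
have [p mp /rootP pt] := intS t.
have : Q (map_poly f p).[t] by rewrite pt; exact: ideal0.
elim/poly_ind: p mp {pt} => [|p c IH] mp.
  by move: mp; rewrite monicE lead_coef0 eq_sym oner_eq0.
rewrite rmorphD rmorphM /= map_polyX map_polyC hornerD hornerMX hornerC /= => Qpt.
have c0 : c = 0.
  apply: P0; rewrite -[f c](addKr ((map_poly f p).[t] * t)) addrC.
  by apply: idealB => //; [exact: sQP | exact: ideal_mull].
move: mp Qpt; rewrite c0 !rmorph0 !addr0 monicE lead_coefMX -monicE => mp.
by move=> /pQ[/(IH mp)|].
Qed.

End IntegralExtensions.

(** * Splitting [R] from its finite extensions *)

Lemma monic_poly_of_coefs (R : comNzRingType) (q : {poly R}) n :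
  q \is monic -> size q = n.+1 ->
  monic_poly_of (fun j : 'I_n => q`_(n - j.+1)) = q.
Proof.
move=> mq sq; rewrite -[RHS]coefK poly_def sq big_ord_recr /=.
rewrite (monic_coef mq sq) scale1r addrC /monic_poly_of; congr (_ + _).
rewrite (reindex_inj rev_ord_inj) /=; apply: eq_bigr => i _.
by rewrite mul_polyC subnSK // subKn // ltnW.
Qed.

Lemma kernel_prime (T S : comNzRingType) (h : {rmorphism T -> S}) :
  (forall x y : S, x * y = 0 -> x = 0 \/ y = 0) ->
  prime_ideal (fun t => h t = 0).
Proof.
move=> domS; split.
  split; first by rewrite rmorph0.
  by split=> [x y hx hy|a x hx]; rewrite ?rmorphD ?rmorphM hx ?hy ?addr0 ?mulr0.
split=> [/eqP|x y]; first by rewrite rmorph1 oner_eq0.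
by rewrite rmorphM; exact: domS.
Qed.

Lemma kernel_height_zero (R T S : comNzRingType) (g : {rmorphism R -> T})
  (h : {rmorphism T -> S}) :
  (forall x y : S, x * y = 0 -> x = 0 \/ y = 0) ->
  integralRange g -> (forall x, h (g x) = 0 -> x = 0) ->
  height_zero (fun t => h t = 0).
Proof.
move=> domS intT inj; have pJ := kernel_prime h domS.
exists (fun t => h t = 0); split=> //; split=> // -[c [[pc sc] cJ]].
have [s01 [x [c1x nc0x]]] := sc 0%N isT; apply: nc0x.
apply: (incomparable intT pJ (pc 0%N isT) _ inj); last exact/cJ.
by move=> t /s01 /cJ.
Qed.

(** The hypothesis of [theorem5]. A retraction of [T/J] onto [R] is encoded as a map on [T]
    vanishing on [J], which avoids constructing [T/J]. *)
Definition quotients_split (R : comNzRingType) (m : R -> Prop) : Prop :=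
  forall (r : nat) (n : 'I_r -> nat) (a : forall i : 'I_r, 'I_(n i) -> R),
  (0 < r)%N -> (forall i, (0 < n i)%N) -> (forall i j, m (a i j)) ->
  forall (T : comNzRingType) (g : {rmorphism R -> T}) (y : 'I_r -> T),
    is_poly_quotient (fun i => monic_poly_of (a i)) g y ->
    forall J : T -> Prop, is_ideal J -> height_zero J ->
    (forall x, J (g x) -> x = 0) ->
    exists rho : T -> R, R_linear g rho /\ rho 1 = 1 /\ (forall t, J t -> rho t = 0).

Lemma summand_domain (R : comNzRingType) (m : R -> Prop)
  (HR : complete_regular_local_alg_closed m)
  (Hsummand : quotients_split m)
  (S : comNzRingType) (f : {rmorphism R -> S}) :
  (forall x y : S, x * y = 0 -> x = 0 \/ y = 0) ->
  (forall x, f x = 0 -> x = 0) -> module_finite f -> direct_summand f.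
Proof.
move=> domS inj fin; have [_ [hm [compl [_ algc]]]] := HR.
have [s gen] := fin; pose r := size s.
(* The generating list is nonempty because 1 differs from 0 in [S]. *)
have r0 : (0 < r)%N.
  rewrite lt0n size_eq0; apply/eqP => s0; have [c] := gen 1.
  by rewrite s0 big_ord0 => /eqP; rewrite oner_eq0.
have /choice[w hw] (i : 'I_r) : exists w : R * {poly R} * nat,
    [/\ w.1.2 \is monic, size w.1.2 = w.2.+2,
      (map_poly f w.1.2).[s`_i - f w.1.1] = 0 & forall j, (j <= w.2)%N -> m w.1.2`_j].
  have [c [q [n hq]]] := integral_translate hm compl algc domS
    (module_finite_integral fin s`_i).
  by exists (c, q, n).
pose n i := (w i).2.+1.
pose a i (j : 'I_(n i)) := (w i).1.2`_(n i - j.+1).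
have Fa i : monic_poly_of (@a i) = (w i).1.2.
  by have [mq sq _ _] := hw i; exact: monic_poly_of_coefs.
have [|T [g [y [univT intT]]]] := @poly_quotient_exists R r (fun i => monic_poly_of (@a i)).
  by move=> i; rewrite Fa; have [-> -> _ _] := hw i.
(* The variable [y i] goes to the translated generator; adding the constant back in [T] shows below
   that [h] is onto. *)
have [|[h [hg hy]] _] := univT.2 S f (fun i => s`_i - f (w i).1.1).
  by move=> i; rewrite Fa; have [] := hw i.
have injJ x : h (g x) = 0 -> x = 0 by rewrite hg; exact: inj.
have [|||||rho [rhoL [rho1 rhoJ]]] := @Hsummand r n a r0 _ _ T g y univT (fun t => h t = 0).
- by [].
- by move=> i j; have [_ _ _] := hw i; apply; rewrite /n; lia.
- exact: (kernel_prime h domS).1.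
- exact: kernel_height_zero intT injJ.
- exact: injJ.
(* Thus [rho] factors through [h], and any choice of preimages yields the retraction of [S]. *)
have rhoB t u : h t = h u -> rho t = rho u.
  move=> e; have := rhoL 1 (t - u) u; rewrite rmorph1 mul1r subrK mul1r => ->.
  by rewrite rhoJ ?add0r // rmorphB e subrr.
have /choice[sec secK] (x : S) : exists t, h t = x.
  have [c ->] := gen x; exists (\sum_(i < r) g c`_i * (y i + g (w i).1.1)).
  rewrite rmorph_sum; apply: eq_bigr => i _.
  by rewrite rmorphM rmorphD !hg hy subrK.
exists (fun x => rho (sec x)); split; last first.
  by rewrite -rho1; apply: rhoB; rewrite secK rmorph1.
move=> b x z; rewrite -rhoL; apply: rhoB.
by rewrite rmorphD rmorphM hg !secK.
Qed.

Theorem theorem5 (R : comNzRingType) (m : R -> Prop)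
  (HR : complete_regular_local_alg_closed m)
  (Hsummand : forall (r : nat) (n : 'I_r -> nat) (a : forall i : 'I_r, 'I_(n i) -> R),
     (0 < r)%N -> (forall i, (0 < n i)%N) -> (forall i j, m (a i j)) ->
     forall (T : comNzRingType) (g : {rmorphism R -> T}) (y : 'I_r -> T),
       is_poly_quotient (fun i => monic_poly_of (a i)) g y ->
       forall J : T -> Prop, is_ideal J -> height_zero J ->
       (* R -> T/J is injective *)
       (forall x, J (g x) -> x = 0) ->
       (* R is a direct summand of T/J: an R-linear T/J -> R sending 1 to 1 *)
       exists rho : T -> R, R_linear g rho /\ rho 1 = 1 /\ (forall t, J t -> rho t = 0)) :
  forall (S : comNzRingType) (f : {rmorphism R -> S}),
    injective f -> module_finite f -> direct_summand f.
Proof.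
move=> S f inj [s gen]; have [noeR [hm [_ [reg _]]]] := HR.
have domR := regular_local_domain noeR hm reg.
(* The nonzero elements of [R] form a multiplicative set because [R] is a domain; a prime of [S]
   avoiding their images meets [R] in 0. *)
pose A (z : S) := exists2 x, x <> 0 & z = f x.
have [|||P [hP [P1 pP]] avP] := @prime_avoiding S A.
- by exists 1; [apply/eqP; exact: oner_neq0 | rewrite rmorph1].
- move=> _ _ [x x0 ->] [y y0 ->]; exists (x * y); last by rewrite rmorphM.
  by move=> /domR[].
- by move=> [x x0 /esym]; rewrite -(rmorph0 f) => /inj.
have [Q [pi [pi_surj pi_ker]]] := quotient_ring hP P1.
pose f' : {rmorphism R -> Q} := (pi \o f)%FUN.
have [|||rho [rhoL rho1]] := @summand_domain R m HR Hsummand Q f'.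
- move=> u v; have [x <-] := pi_surj u; have [y <-] := pi_surj v.
  by rewrite -rmorphM => /pi_ker/pP[] /pi_ker; [left | right].
- move=> x /pi_ker Px; apply: contrapT => x0; apply: (avP _ Px).
  by exists x.
- exists [seq pi z | z <- s] => u; have [x <-] := pi_surj u.
  have [c ->] := gen x; exists c; rewrite size_map rmorph_sum.
  by apply: eq_bigr => i _; rewrite rmorphM (nth_map 0).
exists (rho \o pi); split; last by rewrite /= rmorph1.
by move=> a x y; rewrite /= rmorphD rmorphM rhoL.
Qed.
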